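(* Unless the Strong Exponential Time Hypothesis (SETH) fails, every algorithm that decides CIS has run time $\Omega(\delta_2^n)$, where $n$ is the number of vertices of the input graph system and $\delta_2=\sqrt{2}$.
   Context: A graph system is a tuple $\mathcal{G}=(G_0,G_1,\ldots,G_m)$ with $m\ge 1$, where all $G_i$ are graphs over the same finite vertex set $V$, $G_0$ is an undirected graph without self-loops, and $G_1,\ldots,G_m$ are directed graphs that may contain self-loops. Let $E_i$ be the edge set of $G_i$. For $\Gamma\subseteq V$ and $1\le i\le m$, a vertex $u\in\Gamma$ is $G_i$-good in $\Gamma$ if there is $v\in\Gamma$ (possibly $v=u$) with $(u,v)\in E_i$; it is good in $\Gamma$ if it is $G_i$-good in $\Gamma$ for every $1\le i\le m$. A good independent set (GIS) is a non-empty set $\Gamma\subseteq V$ that is independent in $G_0$ and all of whose vertices are good in $\Gamma$. CIS (Conditional Independent Set) is the problem: given a graph system $\mathcal{G}$, decide whether it has a GIS. For an integer $k\ge 3$, let $c_k$ be the infimum of the real numbers $\varepsilon$ such that there is a (deterministic or randomized) algorithm deciding $k$-SAT in time $O(\varepsilon^N)$, where $N$ is the number of Boolean variables. SETH states that $\lim_{k\to\infty}c_k=2$. *)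

(* Defs.v *)
From HB Require Import structures.
From mathcomp Require Import all_boot all_order all_algebra.
From mathcomp Require Import all_classical all_reals all_analysis.

Set Implicit Arguments.
Unset Strict Implicit.
Unset Printing Implicit Defensive.

Import Order.TTheory GRing.Theory Num.Theory.
Import numFieldNormedType.Exports.

Local Open Scope nat_scope.

(* Algorithms are programs of a randomized random-access machine with the     *)
(* logarithmic cost criterion (Cook-Reckhow).  Its control flow is structured *)
(* (sequence, while), which changes running times by a constant factor at     *)
(* most.  A deterministic algorithm is a program that does not use Flip.      *)
(* The machine has registers, of which a program names finitely many, and a   *)
(* memory that is accessible through ReadMem and WriteMem only.               *)
Inductive program : Type :=
| SetConst of nat & nat       (* SetConst x k : r_x := k *)
| SetAdd of nat & nat & nat   (* SetAdd x y z : r_x := r_y + r_z *)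
| SetSub of nat & nat & nat   (* SetSub x y z : r_x := r_y - r_z, truncated at 0 *)
| ReadMem of nat & nat        (* ReadMem x y  : r_x := memory[r_y] *)
| WriteMem of nat & nat       (* WriteMem x y : memory[r_x] := r_y *)
| Flip of nat                 (* Flip x       : r_x := a uniformly random bit *)
| Seq of program & program
| While of nat & program.     (* While x p    : while r_x <> 0 do p *)

Record config := Config {
  todo : seq program;
  regs : nat -> nat;
  memory : nat -> nat;
  clock : nat                 (* cost of the steps made so far *)
}.

Definition update (f : nat -> nat) (a v : nat) : nat -> nat :=
  fun i => if i == a then v else f i.

(* The length of v in binary, with bitlen 0 = 1. *)
Definition bitlen (v : nat) : nat := (trunc_log 2 v).+1.

(* Each step is handed a coin b, which only Flip looks at. *)
Definition step (b : bool) (c : config) : config :=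
  let: Config s r m t := c in
  match s with
  | [::] => c
  | SetConst x k :: s' => Config s' (update r x k) m (t + bitlen k).+1
  | SetAdd x y z :: s' =>
      Config s' (update r x (r y + r z)) m (t + bitlen (r y) + bitlen (r z)).+1
  | SetSub x y z :: s' =>
      Config s' (update r x (r y - r z)) m (t + bitlen (r y) + bitlen (r z)).+1
  | ReadMem x y :: s' =>
      Config s' (update r x (m (r y))) m
             (t + bitlen (r y) + bitlen (m (r y))).+1
  | WriteMem x y :: s' =>
      Config s' r (update m (r x) (r y)) (t + bitlen (r x) + bitlen (r y)).+1
  | Flip x :: s' => Config s' (update r x b) m t.+1
  | Seq p q :: s' => Config [:: p, q & s'] r m t.+1
  | While x p :: s' =>
      Config (if r x != 0 then [:: p, While x p & s'] else s') r m
             (t + bitlen (r x)).+1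
  end.

Definition start (p : program) (w : seq nat) : config :=
  Config [:: p] (fun=> 0) (nth 0 w) 0.

Definition run (p : program) (w : seq nat) (coins : seq bool) : config :=
  foldl (fun c b => step b c) (start p w) coins.

Definition halted (c : config) : bool := nilp (todo c).

Definition output (c : config) : bool := regs c 0 != 0.

(* On input w, p always halts, and answers b with probability at least 2/3.   *)
Definition answers (p : program) (w : seq nat) (b : bool) : Prop :=
  exists t : nat,
    (forall coins : t.-tuple bool, halted (run p w coins)) /\
    2 * 2 ^ t <=
      3 * #|[set coins : t.-tuple bool | output (run p w coins) == b]|.

(* A CNF formula over N variables; the literal (i, b) asserts that variable i *)
(* has value b.  A k-CNF formula has no repeated clause, so that its size is  *)
(* polynomial in N and a time bound in terms of N alone is meaningful.        *)
Definition cnf (N : nat) := seq (seq ('I_N * bool)).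

Definition is_kcnf (k N : nat) (F : cnf N) : bool :=
  uniq F && all (fun C => size C <= k) F.

Definition satisfiable (N : nat) (F : cnf N) : bool :=
  [exists a : {ffun 'I_N -> bool}, all (has (fun l => a l.1 == l.2)) F].

Definition encode_cnf (N : nat) (F : cnf N) : seq nat :=
  [:: N, size F &
    flatten [seq size C :: [seq (l : 'I_N * bool).1.*2 + l.2 | l <- C]
            | C <- F]].

Definition decides_kSAT (k : nat) (p : program) : Prop :=
  forall (N : nat) (F : cnf N),
    is_kcnf k F -> answers p (encode_cnf F) (satisfiable F).

(* (G_0, G_1, ..., G_m) is (graph0, digraphs), with m = size digraphs.        *)
Record graph_system (V : finType) := GraphSystem {
  graph0 : rel V;
  digraphs : seq (rel V);
  graph0_sym : symmetric graph0;
  graph0_irr : irreflexive graph0;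
  digraphs_gt0 : 0 < size digraphs
}.

Section GIS.
Variables (V : finType) (G : graph_system V).

Definition good_for (E : rel V) (Gamma : {set V}) (u : V) : bool :=
  [exists v in Gamma, E u v].

Definition good (Gamma : {set V}) (u : V) : bool :=
  all (fun E => good_for E Gamma u) (digraphs G).

Definition independent (Gamma : {set V}) : bool :=
  [forall u in Gamma, forall v in Gamma, ~~ graph0 G u v].

Definition is_GIS (Gamma : {set V}) : bool :=
  [&& Gamma != finset.set0, independent Gamma & [forall u in Gamma, good Gamma u]].

Definition has_GIS : bool := [exists Gamma : {set V}, is_GIS Gamma].

End GIS.

Definition encode_rel (n : nat) (E : rel 'I_n) : seq nat :=
  [seq nat_of_bool (E u v) | u <- enum 'I_n, v <- enum 'I_n].

Definition encode_system (n : nat) (G : graph_system 'I_n) : seq nat :=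
  [:: n, size (digraphs G) &
    encode_rel (graph0 G) ++ flatten [seq encode_rel E | E <- digraphs G]].

Definition decides_CIS (p : program) : Prop :=
  forall (n : nat) (G : graph_system 'I_n),
    answers p (encode_system G) (has_GIS G).

Local Open Scope classical_set_scope.
Local Open Scope ring_scope.

Definition kSAT_inputs (k N : nat) : set (seq nat) :=
  [set encode_cnf F | F in [set F : cnf N | is_kcnf k F]].

Definition CIS_inputs (n : nat) : set (seq nat) :=
  [set encode_system G | G in [set: graph_system 'I_n]].

Definition CIS_poly_inputs (d n : nat) : set (seq nat) :=
  [set encode_system G
  | G in [set G : graph_system 'I_n | (size (digraphs G) <= n ^ d)%N]].

Section Growth.
Variable R : realType.

(* Worst case over the inputs in X and over all coins; it may be +oo. *)
Definition worst_time (p : program) (X : set (seq nat)) : \bar R :=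
  ereal_sup [set t | exists2 w, X w &
                     exists coins, t = ((clock (run p w coins))%:R)%:E].

Definition is_O (T : nat -> \bar R) (f : nat -> R) : Prop :=
  exists (C : R) (n0 : nat),
    forall n, (n0 <= n)%N -> (T n <= (C * f n)%:E)%E.

Definition is_Omega (T : nat -> \bar R) (f : nat -> R) : Prop :=
  exists (c : R) (n0 : nat), 0 < c /\
    forall n, (n0 <= n)%N -> ((c * f n)%:E <= T n)%E.

Definition kSAT_const (k : nat) : R :=
  inf [set e : R | 0 < e /\ exists p : program, decides_kSAT k p /\
         is_O (fun N => worst_time p (kSAT_inputs k N)) (fun N => e ^+ N)].

Definition SETH : Prop := kSAT_const k @[k --> \oo] --> (2 : R).

End Growth.

(* Main.v *)
(** A k-CNF formula over N variables is turned into a graph system whose vertices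
    are the n = 2 (N + 1) literals 2 i + b over N + 1 variables (the extra one
    keeps the vertex set non-empty).  G_0 joins complementary literals, and each
    clause C gives a digraph in which every vertex points to the literals of C.
    A GIS is then a consistent set of literals that meets every clause; it need
    not be a total assignment.  The reduction takes time polynomial in N for
    fixed k and n = 2 N + O(1), so a base e < sqrt 2 for CIS yields a base close
    to e ^ 2 < 2 for k-SAT for every k, against SETH.

    The bound on all inputs does not need SETH: among 3 T + 1 complete digraphs,
    a program running in time T leaves some digraph unread with probability more
    than 2/3, and emptying this one changes the answer. *)
Require Import Defs.
From mathcomp Require Import all_boot all_order all_algebra.
From mathcomp Require Import all_classical all_reals all_analysis.
From mathcomp Require Import zify.

(** * Runs of the machine, their composition and their cost *)

Section Machine.
Local Open Scope nat_scope.
Local Set Implicit Arguments.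
Local Unset Strict Implicit.

Definition steps (c : config) (coins : seq bool) : config :=
  foldl (fun c b => step b c) c coins.

Lemma steps_cat c s1 s2 : steps c (s1 ++ s2) = steps (steps c s1) s2.
Proof. exact: foldl_cat. Qed.

Lemma halted_step b c : halted c -> step b c = c.
Proof. by case: c => -[|? ?]. Qed.

Lemma halted_steps c coins : halted c -> steps c coins = c.
Proof. by move=> hc; elim: coins => //= b s IH; rewrite halted_step. Qed.

Lemma clock_step b c : ~~ halted c -> clock c < clock (step b c).
Proof.
case: c => -[|[x k|x y z|x y z|x y|x y|x|p q|x p] s'] r m t //= _.
all: by rewrite ltnS -?addnA leq_addr.
Qed.

Lemma clock_steps c coins : clock c <= clock (steps c coins).
Proof.
elim: coins c => //= b s IH c; apply: leq_trans (IH _).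
by case: (boolP (halted c)) => [/halted_step->|/clock_step/ltnW].
Qed.

(** No step depends on the clock, so a program started at a later time behaves as if started at time
    0. *)
Definition shift_clock (t : nat) (c : config) : config :=
  Config (todo c) (regs c) (memory c) (t + clock c).

Lemma shift_clock_step t b c : shift_clock t (step b c) = step b (shift_clock t c).
Proof.
by case: c => -[|[x k|x y z|x y z|x y|x y|x|p q|x p] s'] r m t' //=;
  rewrite /shift_clock /= ?addnS ?addnA.
Qed.

Lemma shift_clock_steps t c coins :
  steps (shift_clock t c) coins = shift_clock t (steps c coins).
Proof.
elim: coins c => // b s IH c.
by rewrite -[RHS](IH (step b c)) shift_clock_step.
Qed.

(** A linear bound on a logarithm is enough: the cost of the reduction only has to be polynomial. *)
Lemma bitlen_le v V : v <= V -> bitlen v <= V.+1.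
Proof.
move=> leV; rewrite /bitlen ltnS; apply: leq_trans leV.
by case: v => // v; rewrite (leq_trans (ltnW (ltn_expl _ (ltnSn 1)))) ?trunc_logP.
Qed.

(** Registers form a list read with default 0, so that concrete register contents can be compared
    entry by entry. *)
Definition state : Type := (seq nat * (nat -> nat))%type.

Section Runs.
Variable V : nat.

(* Every step of the run costs at most 2 * V + 3: no operand exceeds V. *)
Definition runs (p : program) (x y : state) (s : nat) : Prop :=
  exists2 h, h <= s & forall td t coins, size coins = h ->
    exists2 t', t' <= t + h * (2 * V + 3) &
      steps (Config (p :: td) (nth 0 x.1) x.2 t) coins =
      Config td (nth 0 y.1) y.2 t'.

Lemma runs_le p x y s s' : s <= s' -> runs p x y s -> runs p x y s'.
Proof. by move=> les [h leh hP]; exists h => //; apply: leq_trans les. Qed.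

(** The number of steps of [p] is the same for all coins, so every coin sequence splits at the same
    place. *)
Lemma runs_seq p q x y z s1 s2 :
  runs p x y s1 -> runs q y z s2 -> runs (Seq p q) x z (s1 + s2).+1.
Proof.
move=> [h1 le1 P1] [h2 le2 P2]; exists (h1 + h2).+1; first by lia.
move=> td t [|b coins] //= [szc].
have [|t1 let1] := P1 (q :: td) t.+1 (take h1 coins).
  by rewrite size_takel // szc leq_addr.
move=> E1; have [|t2 let2] := P2 td t1 (drop h1 coins).
  by rewrite size_drop szc addKn.
move=> E2; exists t2; first by lia.
by rewrite -{1}(cat_take_drop h1 coins) -E2 -E1 -steps_cat.
Qed.

Lemma runs_while0 x p l m : nth 0 l x = 0 -> runs (While x p) (l, m) (l, m) 1.
Proof.
move=> lx; exists 1 => // td t [|b [|]] //= _.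
by rewrite lx; eexists; last reflexivity; rewrite /bitlen trunc_log0; lia.
Qed.

Lemma runs_whileS x p a b c s1 s2 : nth 0 a.1 x != 0 -> nth 0 a.1 x <= V ->
  runs p a b s1 -> runs (While x p) b c s2 -> runs (While x p) a c (s1 + s2).+1.
Proof.
move=> nz leV [h1 le1 P1] [h2 le2 P2]; exists (h1 + h2).+1; first by lia.
move=> td t [|c0 coins] //= [szc]; rewrite nz.
have leb := bitlen_le leV.
have [|t1 let1] := P1 (While x p :: td) (t + bitlen (nth 0 a.1 x)).+1 (take h1 coins).
  by rewrite size_takel // szc leq_addr.
move=> E1; have [|t2 let2] := P2 td t1 (drop h1 coins).
  by rewrite size_drop szc addKn.
move=> E2; exists t2; first by lia.
by rewrite -{1}(cat_take_drop h1 coins) -E2 -E1 -steps_cat.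
Qed.

(** [st i] is the state at the [i]-th loop test, and [x] counts down to 0. The induction is on the
    number [d] of iterations left; the final successor pays for the failing test. *)
Lemma runs_loop x p (st : nat -> state) J s : J <= V ->
  (forall i, i <= J -> nth 0 (st i).1 x = J - i) ->
  (forall i, i < J -> runs p (st i) (st i.+1) s) ->
  runs (While x p) (st 0) (st J) (J * s.+1).+1.
Proof.
move=> JV xE body.
suff H d : d <= J -> runs (While x p) (st (J - d)) (st J) (d * s.+1).+1.
  by have := H J (leqnn J); rewrite subnn.
elim: d => [_|d IH dJ].
  rewrite subn0 mul0n; have := xE J (leqnn J); case: (st J) => l m /= lx.
  by apply: runs_while0; rewrite lx subnn.
have xd : nth 0 (st (J - d.+1)).1 x = d.+1 by rewrite xE; lia.
apply: (@runs_le _ _ _ (s + (d * s.+1).+1).+1); first by lia.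
apply: (@runs_whileS _ _ _ (st (J - d))); rewrite ?xd //.
- by lia.
- by have -> : J - d = (J - d.+1).+1 by [lia]; apply: body; lia.
- by apply: IH; lia.
Qed.

Fixpoint straight (p : program) : bool :=
  match p with
  | Flip _ | While _ _ => false
  | Seq p q => straight p && straight q
  | _ => true
  end.

(** Symbolic execution, meaningful for [straight] programs only: [Flip] and [While] are treated as
    no-ops. *)
Fixpoint eval (p : program) (x : state) : state :=
  let: (l, m) := x in
  match p with
  | SetConst x k => (set_nth 0 l x k, m)
  | SetAdd x y z => (set_nth 0 l x (nth 0 l y + nth 0 l z), m)
  | SetSub x y z => (set_nth 0 l x (nth 0 l y - nth 0 l z), m)
  | ReadMem x y => (set_nth 0 l x (m (nth 0 l y)), m)
  | WriteMem x y => (l, update m (nth 0 l x) (nth 0 l y))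
  | Seq p q => eval q (eval p (l, m))
  | _ => (l, m)
  end.

(** The numbers whose binary lengths are charged when [p] is executed. *)
Fixpoint operands (p : program) (x : state) : seq nat :=
  let: (l, m) := x in
  match p with
  | SetConst _ k => [:: k]
  | SetAdd _ y z | SetSub _ y z | WriteMem y z => [:: nth 0 l y; nth 0 l z]
  | ReadMem _ y => [:: nth 0 l y; m (nth 0 l y)]
  | Seq p q => operands p (l, m) ++ operands q (eval p (l, m))
  | _ => [::]
  end.

Fixpoint instr_count (p : program) : nat :=
  if p is Seq p q then (instr_count p + instr_count q).+1 else 1.

Lemma update_nth l x v : update (nth 0 l) x v = nth 0 (set_nth 0 l x v).
Proof. by apply/funext => i; rewrite nth_set_nth. Qed.

Lemma runs_straight p x : straight p -> all (fun v => v <= V) (operands p x) ->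
  runs p x (eval p x) (instr_count p).
Proof.
elim: p x => [x k|x y z|x y z|x y|x y|x|p IHp q IHq|x p _] [l m] //=; last first.
  move=> /andP[sp sq]; rewrite all_cat => /andP[op oq].
  by apply: runs_seq; [apply: IHp|apply: IHq].
all: move=> _ H; exists 1 => // td t [|b [|]] //= _; rewrite ?update_nth.
all: eexists; last reflexivity.
all: rewrite andbT in H.
all: by (case/andP: H => /bitlen_le H1 /bitlen_le H2; lia) || (move/bitlen_le: H; lia).
Qed.

Lemma runs_straight_eq p x y s : straight p ->
  all (fun v => v <= V) (operands p x) -> eval p x = y -> instr_count p <= s ->
  runs p x y s.
Proof. by move=> sp op <- les; apply: runs_le les _; apply: runs_straight. Qed.

End Runs.
End Machine.

(** * The reduction from k-SAT to CIS as a machine program, and its verification *)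

Section Reduction.
Local Open Scope nat_scope.
Local Set Implicit Arguments.
Local Unset Strict Implicit.

(* rZ is always 0 and rOne is 1.  In the n x n loop of block, rU and rV are the
   indices, rRows and rCols count down, and rPar is the parity of rU.  rQ points
   to the end of the output, which grows from address 0, while the input has
   been moved up to address rB.  rP points to the current clause, of size rS;
   rJ clauses are left. *)
Local Notation rOne := 0 (only parsing).
Local Notation rN := 1 (only parsing).
Local Notation rB := 2 (only parsing).
Local Notation rQ := 3 (only parsing).
Local Notation rRows := 4 (only parsing).
Local Notation rU := 5 (only parsing).
Local Notation rPar := 6 (only parsing).
Local Notation rCols := 7 (only parsing).
Local Notation rV := 8 (only parsing).
Local Notation rBit := 9 (only parsing).
Local Notation rP := 10 (only parsing).
Local Notation rS := 11 (only parsing).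
Local Notation rJ := 12 (only parsing).
Local Notation rA := 13 (only parsing).
Local Notation rC := 14 (only parsing).
Local Notation rL := 15 (only parsing).
Local Notation rD := 16 (only parsing).
Local Notation rZ := 17 (only parsing).

Local Notation frame n B q ru u par rv v bit p s j a c l d :=
  [:: 1; n; B; q; ru; u; (par : nat); rv; v; (bit : nat); p; s; j; a; c; l; d; 0]
  (only parsing).

Local Notation "p ;; q" := (Seq p q) (at level 90, right associativity).
Local Notation copy x y := (SetAdd x y rZ).
Local Notation clear x := (SetConst x 0).
Local Notation incr x := (SetAdd x x rOne).
Local Notation decr x := (SetSub x x rOne).

(** Multiplication by repeated addition: [rD] grows by [rC * rL], and [rC] ends at 0. *)
Definition mul_acc := While rC (SetAdd rD rD rL ;; decr rC).

Definition load_sizes :=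
  SetConst rOne 1 ;; ReadMem rN rZ ;; incr rN ;; SetAdd rN rN rN ;;
  ReadMem rJ rOne ;; copy rL rN ;; copy rC rN.

(* Together with the two calls of mul_acc, computes in rD the address
   2 + (M + 2) (n ^ 2 + K), which exceeds the lengths of input and output. *)
Definition scale_area (K : nat) :=
  SetConst rA K ;; SetAdd rD rD rA ;; copy rL rD ;;
  SetAdd rC rJ rOne ;; incr rC ;; SetConst rD 2.

Definition store_base := copy rB rD ;; clear rD ;; clear rL ;; clear rA ;; copy rC rB.

(** The input is moved out of the way because the output, growing from address 0, would overwrite
    clauses still to be read. *)
Definition move_body :=
  ReadMem rL rA ;; SetAdd rD rB rA ;; WriteMem rD rL ;; WriteMem rA rZ ;;
  clear rL ;; clear rD ;; incr rA ;; decr rC.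

Definition header :=
  clear rA ;; WriteMem rQ rN ;; incr rQ ;; SetAdd rBit rJ rOne ;;
  WriteMem rQ rBit ;; incr rQ ;; clear rBit.

(** Writes an n x n matrix row by row; [bc] leaves in [rBit] the entry at position ([rU], [rV]). *)
Definition block (bc : program) :=
  copy rRows rN ;;
  While rRows (copy rCols rN ;;
    While rCols (bc ;; WriteMem rQ rBit ;; incr rQ ;; clear rBit ;; incr rV ;; decr rCols) ;;
    clear rV ;; incr rU ;; SetSub rPar rOne rPar ;; decr rRows) ;;
  clear rU ;; clear rPar.

(* The sum of the two truncated differences is |rV - rD|. *)
Definition partner_bit :=
  SetAdd rD rU rOne ;; SetSub rD rD rPar ;; SetSub rD rD rPar ;;
  SetSub rL rV rD ;; SetSub rD rD rV ;; SetAdd rD rD rL ;;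
  SetSub rBit rOne rD ;; clear rL ;; clear rD.

(** Truncated subtraction of |[rL] - [rV]| from 1 tests equality. [rBit] counts the hits, and
    subtracting twice from 1 caps this count at 1. *)
Definition clause_bit :=
  (copy rA rP ;; copy rC rS) ;;
  While rC (ReadMem rL rA ;; SetSub rD rL rV ;; SetSub rL rV rL ;;
    SetAdd rL rL rD ;; SetSub rL rOne rL ;; SetAdd rBit rBit rL ;;
    clear rL ;; clear rD ;; incr rA ;; decr rC) ;;
  SetSub rBit rOne rBit ;; SetSub rBit rOne rBit ;; clear rA.

Definition clauses :=
  (copy rP rB ;; incr rP ;; incr rP) ;;
  While rJ ((ReadMem rS rP ;; incr rP) ;; block clause_bit ;;
    SetAdd rP rP rS ;; clear rS ;; decr rJ) ;;
  clear rP ;; copy rC rB ;; copy rA rB.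

Definition erase_body := WriteMem rA rZ ;; incr rA ;; decr rC.

(** The CIS program that follows must find all registers at 0, as in [start]. *)
Definition reset := clear rA ;; clear rQ ;; clear rN ;; clear rB ;; clear rOne.

(** [K] only enters the address [rB]. It will be k + 1, the space taken by a clause of k literals
    together with its length. *)
Definition reduction (K : nat) :=
  load_sizes ;; mul_acc ;; scale_area K ;; mul_acc ;; store_base ;;
  While rC move_body ;; header ;; block partner_bit ;; block (SetConst rBit 1) ;;
  clauses ;; While rC erase_body ;; reset.

(** The complementary literal: the last bit of [u] is flipped. The formula is the one evaluated by
    [partner_bit]. *)
Definition partner (u : nat) : nat := u.+1 - odd u - odd u.

Definition square (n : nat) (f : nat -> nat -> nat) : seq nat :=
  flatten (mkseq (fun u => mkseq (f u) n) n).

Lemma size_flatten_mkseq (f : nat -> seq nat) b n :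
  (forall i, size (f i) = b) -> size (flatten (mkseq f n)) = n * b.
Proof.
move=> szf; elim: n => // n IH.
by rewrite mkseqS flatten_rcons size_cat IH szf mulSn addnC.
Qed.

Lemma size_square n f : size (square n f) = n * n.
Proof. by apply: size_flatten_mkseq => i; rewrite size_mkseq. Qed.

(** The output [xs] written so far lies over the memory [base]; a write at address [size xs], where
    [rQ] points, appends one entry. *)
Definition tape (base : nat -> nat) (xs : seq nat) : nat -> nat :=
  fun a => if a < size xs then nth 0 xs a else base a.

Lemma update_tape base xs v : update (tape base xs) (size xs) v = tape base (rcons xs v).
Proof.
apply/funext => a; rewrite /update /tape size_rcons nth_rcons ltnS.
by case: ltngtP.
Qed.

Ltac arith := 
  lazymatch goal with
  | |- @eq _ (cons _ _) (cons _ _) => congr (_ :: _); arith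
  | |- @eq _ (pair _ _) (pair _ _) => congr pair; arith
  | |- @eq nat _ _ => try first [reflexivity | lia]
  | _ => try reflexivity
  end.

Ltac straight_line := apply: runs_straight_eq => //=;
  lazymatch goal with |- is_true _ => try lia | |- _ => try by arith end.

Section Block.
Variables (V n B : nat) (base : nat -> nat) (p s j : nat).
Hypotheses (BV : B <= V) (nB : n <= B).

Variables (bc : program) (f : nat -> nat -> nat) (h : nat).
Hypothesis f1 : forall u v, f u v <= 1.
Hypothesis bcP : forall ru rv u v (xs : seq nat), u < n -> v < n -> size xs < B ->
  runs V bc
    (frame n B (size xs) ru u (odd u) rv v 0 p s j 0 0 0 0, tape base xs)
    (frame n B (size xs) ru u (odd u) rv v (f u v) p s j 0 0 0 0, tape base xs) h.

(** Two nested loop invariants: [row i] after [i] full rows, and [col k] after [k] entries of row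
    [i]. The bound on the final size keeps each write below [B], where the copy of the input
    begins. *)
Lemma runs_block (xs : seq nat) : size xs + n * n <= B ->
  runs V (block bc)
    (frame n B (size xs) 0 0 0 0 0 0 p s j 0 0 0 0, tape base xs)
    (frame n B (size xs + n * n) 0 0 0 0 0 0 p s j 0 0 0 0, tape base (xs ++ square n f))
    (n * (n * (h + 11) + 12) + 7).
Proof.
move=> szB.
pose rows i := xs ++ flatten (mkseq (fun u => mkseq (f u) n) i).
have sz_rows i : size (rows i) = size xs + i * n.
  by rewrite size_cat (@size_flatten_mkseq _ n) // => k; rewrite size_mkseq.
pose row i := (frame n B (size (rows i)) (n - i) i (odd i) 0 0 0 p s j 0 0 0 0,
               tape base (rows i)).
apply: (@runs_le _ _ _ _ (1 + ((n * (n * (h + 11) + 11).+1).+1 + 3).+1).+1); first by lia.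
apply: (@runs_seq _ _ _ _ (row 0)).
  straight_line.
  by rewrite /row /rows cats0 subn0; arith.
apply: (@runs_seq _ _ _ _ (row n)); last first.
  straight_line.
apply: runs_loop => [|i le_in //|i lt_in]; first by lia.
have inn : i * n + n <= n * n by rewrite -mulSnr leq_mul2r lt_in orbT.
pose col k := (frame n B (size (rows i) + k) (n - i) i (odd i) (n - k) k 0 p s j 0 0 0 0,
               tape base (rows i ++ mkseq (f i) k)).
apply: (@runs_le _ _ _ _ (1 + ((n * (h + 10).+1).+1 + 7).+1).+1); first by lia.
apply: (@runs_seq _ _ _ _ (col 0)).
  straight_line.
  by rewrite /row /col subn0 addn0 cats0; arith.
apply: (@runs_seq _ _ _ _ (col n)); last first.
  straight_line.
  rewrite /row /col subnn; congr pair; last first.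
    by rewrite /rows mkseqS flatten_rcons catA.
  rewrite !sz_rows mulSnr addnA; arith.
apply: runs_loop => [|k le_kn //|k lt_kn]; first by lia.
have szc : size (rows i ++ mkseq (f i) k) = size (rows i) + k by rewrite size_cat size_mkseq.
apply: (@runs_le _ _ _ _ (h + 9).+1); first by lia.
apply: runs_seq.
  rewrite /col -szc; apply: bcP => //; rewrite szc sz_rows; lia.
straight_line; first by rewrite szc sz_rows; have := f1 i k; lia.
rewrite /col mkseqS -rcons_cat -update_tape szc; arith.
Qed.

End Block.


Lemma runs_partner_bit V n B base p s j ru rv u v (xs : seq nat) : 2 * B < V -> n <= B ->
  u < n -> v < n ->
  runs V partner_bit
    (frame n B (size xs) ru u (odd u) rv v 0 p s j 0 0 0 0, tape base xs)
    (frame n B (size xs) ru u (odd u) rv v (v == partner u) p s j 0 0 0 0,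
     tape base xs) 17.
Proof.
move=> BV nB un vn; have := leq_b1 (odd u); set o := nat_of_bool (odd u) => o1.
by straight_line; rewrite /partner -/o; arith.
Qed.

Lemma runs_clause_bit V n B base p c j ru rv u v (xs : seq nat) : n <= B -> size xs < B ->
  B <= p -> p + size c <= V -> all (fun l => l <= V) c ->
  (forall i, i < size c -> base (p + i) = nth 0 c i) ->
  u < n -> v < n ->
  runs V clause_bit
    (frame n B (size xs) ru u (odd u) rv v 0 p (size c) j 0 0 0 0, tape base xs)
    (frame n B (size xs) ru u (odd u) rv v (v \in c) p (size c) j 0 0 0 0,
     tape base xs) (20 * size c + 11).
Proof.
move=> nB xsB Bp pV cV baseE un vn.
(* [k i] is the value of [rBit] after [i] literals. It can exceed 1, as a clause may repeat a
   literal. *)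
have [k [k0 kS k_le kE]] : exists k : nat -> nat,
    [/\ k 0 = 0, forall i, i < size c -> k i.+1 = k i + (nth 0 c i == v),
        forall i, k i <= size c & (v \in c) = (0 < k (size c))].
  exists (fun i => count_mem v (take i c)); split=> [|i lt_i|i|].
  - by rewrite take0.
  - by rewrite (take_nth 0 lt_i) -cats1 count_cat /= addn0.
  - by rewrite (leq_trans (count_size _ _)) // size_take_min geq_minr.
  - by rewrite take_size -has_count has_pred1.
pose st i := (frame n B (size xs) ru u (odd u) rv v (k i) p (size c) j
  (p + i) (size c - i) 0 0, tape base xs).
apply: (@runs_le _ _ _ _ (3 + ((size c * 20).+1 + 5).+1).+1); first by lia.
apply: (@runs_seq _ _ _ _ (st 0)).
  by straight_line; rewrite /st k0; arith.
apply: (@runs_seq _ _ _ _ (st (size c))); last first.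
  straight_line; first by have := k_le (size c); lia.
  by rewrite kE /st; arith.
apply: runs_loop => // [|i lt_i]; first by lia.
have readE : tape base xs (p + i) = nth 0 c i.
  by rewrite /tape baseE //; case: ltnP => //; lia.
have liV : nth 0 c i <= V by apply/(allP cV)/mem_nth.
straight_line; rewrite !readE.
  by have := k_le i; lia.
by rewrite /st kS //; arith; case: eqP; lia.
Qed.


Lemma runs_mul_acc V n j a c l d m : d + c * l <= V -> c < V -> l <= V ->
  runs V mul_acc (frame n 0 0 0 0 0 0 0 0 0 0 j a c l d, m)
                 (frame n 0 0 0 0 0 0 0 0 0 0 j a 0 l (d + c * l), m) (c * 4).+1.
Proof.
move=> dV cV lV.
pose st i := (frame n 0 0 0 0 0 0 0 0 0 0 j a (c - i) l (d + i * l), m) : state.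
have -> : (frame n 0 0 0 0 0 0 0 0 0 0 j a c l d, m) = st 0 by rewrite /st; arith.
have -> : (frame n 0 0 0 0 0 0 0 0 0 0 j a 0 l (d + c * l), m) = st c.
  by rewrite /st subnn.
apply: (@runs_loop _ _ _ st) => [|//|i lt_ic]; first by lia.
have le_il : i * l + l <= c * l by rewrite -mulSnr leq_mul2r lt_ic orbT.
by straight_line; rewrite /st mulSn; arith.
Qed.

(** The input format with literals as plain numbers, which frees the analysis of the program from
    ordinals. *)
Definition formula_code (N : nat) (cs : seq (seq nat)) : seq nat :=
  [:: N, size cs & flatten [seq size c :: c | c <- cs]].

(** The intended output. The successor counts the complete digraph, whose matrix is the square of
    ones. *)
Definition system_code (n : nat) (cs : seq (seq nat)) : seq nat :=
  [:: n; (size cs).+1] ++ square n (fun u v => v == partner u) ++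
  square n (fun _ _ => 1) ++ flatten [seq square n (fun _ v => v \in c) | c <- cs].

Definition offset (cs : seq (seq nat)) (i : nat) : nat :=
  size (flatten [seq size c :: c | c <- take i cs]).

Lemma offsetS cs i : i < size cs -> offset cs i.+1 = offset cs i + (size (nth [::] cs i)).+1.
Proof.
by move=> lt_i; rewrite /offset (take_nth [::] lt_i) map_rcons flatten_rcons size_cat.
Qed.

Lemma nth_offset cs i j : i < size cs -> j <= size (nth [::] cs i) ->
  nth 0 (flatten [seq size c :: c | c <- cs]) (offset cs i + j) =
  nth 0 (size (nth [::] cs i) :: nth [::] cs i) j.
Proof.
move=> lt_i le_j; rewrite -{1}(cat_take_drop i cs) map_cat flatten_cat.
rewrite nth_cat -/(offset cs i) ltnNge leq_addr /= addKn (drop_nth [::] lt_i) /=.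
by case: j le_j => //= j lt_j; rewrite nth_cat lt_j.
Qed.

Lemma size_code k cs : all (fun c => size c <= k) cs ->
  size (flatten [seq size c :: c | c <- cs]) <= size cs * k.+1.
Proof.
elim: cs => //= c cs IH /andP[ck /IH le]; rewrite size_cat mulSn; lia.
Qed.

Section Spec.
Variables (k N : nat) (cs : seq (seq nat)).
Let M := size cs.
Variables n B V : nat.
Hypotheses (nE : n = N.+1 + N.+1) (BE : B = 2 + (M + 2) * (n * n + k.+1)).
Hypothesis VE : V = 2 * B + 5.
Let w := formula_code N cs.
Hypothesis size_cs : all (fun c => size c <= k) cs.
Hypothesis cs_lt : all (all (fun l => l < n)) cs.

(** The memory once the input has been moved. *)
Let base x := if x < B then 0 else nth 0 w (x - B).

Let nB : n <= B. Proof. by rewrite BE; nia. Qed.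
Let MB : M + 2 <= B. Proof. by rewrite BE; nia. Qed.
Let kB : k.+1 <= B. Proof. by rewrite BE; nia. Qed.

Let size_w : size w <= B.
Proof. rewrite /w /= BE -/M; have := size_code size_cs; rewrite -/M; nia. Qed.

Let w_le x : nth 0 w x <= B.
Proof.
case: (ltnP x (size w)) => [lt_x|le_x]; last by rewrite nth_default.
suff /allP/(_ _ (mem_nth 0 lt_x)) : all (fun y => y <= B) w by [].
rewrite /w /= -/M; apply/and3P; split; [lia|lia|].
apply/allP => y /flattenP[s /mapP[c cin ->]]; rewrite inE => /orP[/eqP->|yc].
  by have := allP size_cs _ cin; lia.
by have := allP (allP cs_lt _ cin) _ yc; lia.
Qed.

(** The memory after [i] cells have been moved. As [w] has at most [B] entries, source and target do
    not overlap. *)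
Let moved i x := if x < i then 0 else if B <= x < B + i then nth 0 w (x - B) else nth 0 w x.

Lemma runs_move :
  runs V (While rC move_body)
    (frame n B 0 0 0 0 0 0 0 0 0 M 0 B 0 0, nth 0 w)
    (frame n B 0 0 0 0 0 0 0 0 0 M B 0 0 0, tape base [::]) (B * 16).+1.
Proof.
pose st i := (frame n B 0 0 0 0 0 0 0 0 0 M i (B - i) 0 0, moved i) : state.
have -> : (frame n B 0 0 0 0 0 0 0 0 0 M 0 B 0 0, nth 0 w) = st 0.
  rewrite /st; arith; apply/funext => x.
  by rewrite /moved addn0; case: (ltngtP B x).
have -> : (frame n B 0 0 0 0 0 0 0 0 0 M B 0 0 0, tape base [::]) = st B.
  rewrite /st; arith; apply/funext => x.
  rewrite /moved /tape /base /=; case: ltnP => //= le_Bx; case: ltnP => // lt_x.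
  by rewrite !nth_default //; lia.
apply: (@runs_loop _ _ _ st) => [|//|i lt_i]; first by lia.
have movedE : moved i i = nth 0 w i by rewrite /moved ltnn leqNgt lt_i.
straight_line; rewrite movedE.
  by have := w_le i; lia.
rewrite /st; arith; apply/funext => x; rewrite /update /moved addnS !ltnS.
case: (ltngtP x i) => [lt_xi|lt_ix|_] //.
  by rewrite ifF //; lia.
case: (ltngtP x (B + i)) => [lt_x|lt_x|->]; last by rewrite leq_addr addKn.
  by [].
by rewrite !andbF.
Qed.


(** The output after [i] clauses, given through an equation so that it stays folded. *)
Variable xs : nat -> seq nat.
Hypothesis xsE : forall i, xs i = [:: n; M.+1] ++
  square n (fun u v => v == partner u) ++ square n (fun _ _ => 1) ++
  flatten [seq square n (fun _ v => v \in c) | c <- take i cs].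

Let size_xs i : i <= M -> size (xs i) = 2 + (2 + i) * (n * n).
Proof.
move=> le_i; rewrite xsE !size_cat !size_square.
suff -> : size (flatten [seq square n (fun _ v => v \in c) | c <- take i cs]) = i * (n * n).
  by rewrite /=; lia.
elim: i le_i => [|i IH] lt_i; first by rewrite take0.
by rewrite (take_nth [::] lt_i) map_rcons flatten_rcons size_cat size_square IH; lia.
Qed.

Let offset_le i : i <= M -> offset cs i <= M * k.+1.
Proof.
move=> le_i; rewrite /offset (leq_trans (@size_code k _ _)) //.
  by apply/allP => c /mem_take; apply: (allP size_cs).
by rewrite leq_mul2r size_takel ?le_i ?orbT.
Qed.

Let cs_i i : i < M -> (size (nth [::] cs i) <= k) && all (fun l => l < n) (nth [::] cs i).
Proof.
by move=> lt_i; rewrite (allP size_cs) ?(allP cs_lt) ?mem_nth.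
Qed.

Lemma runs_clauses :
  runs V clauses
    (frame n B (size (xs 0)) 0 0 0 0 0 0 0 0 M 0 0 0 0, tape base (xs 0))
    (frame n B (size (xs M)) 0 0 0 0 0 0 0 0 0 B B 0 0, tape base (xs M))
    (M * (n * (n * (20 * k + 22) + 12) + 19) + 14).
Proof.
(* The offset [B + 2] skips the copies of [N] and of the number of clauses. *)
pose st i := (frame n B (size (xs i)) 0 0 0 0 0 0 (B + 2 + offset cs i) 0 (M - i) 0 0 0 0,
              tape base (xs i)) : state.
pose h := n * (n * (20 * k + 22) + 12) + 7.
apply: (@runs_le _ _ _ _ (5 + ((M * (h + 11).+1).+1 + 5).+1).+1).
  by rewrite /h; lia.
have Bpos : M * k.+1 + 2 <= B by rewrite BE; nia.
have B2 : (M + 2) * (n * n) + 2 <= B by rewrite BE; nia.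
apply: (@runs_seq _ _ _ _ (st 0)).
  have o0 : offset cs 0 = 0 by rewrite /offset take0.
  by straight_line; rewrite /st o0; arith.
apply: (@runs_seq _ _ _ _ (st M)); last first.
  straight_line.
apply: runs_loop => [|//|i lt_i]; first by lia.
have /andP[le_k lt_n] := cs_i lt_i; set c := nth [::] cs i in le_k lt_n.
have le_off := offset_le (ltnW lt_i).
have le_off' := offset_le lt_i; rewrite offsetS // -/c in le_off'.
have sz_i := size_xs (ltnW lt_i).
have le_i : (2 + i) * (n * n) + n * n <= (M + 2) * (n * n).
  by rewrite -mulSnr leq_mul2r; apply/orP; right; lia.
have baseE j : j <= size c -> base (B + 2 + offset cs i + j) = nth 0 (size c :: c) j.
  move=> le_j; rewrite -(nth_offset lt_i le_j) /base ifF; last by lia.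
  by rewrite (_ : _ - B = (offset cs i + j).+2) //; lia.
have readE : tape base (xs i) (B + 2 + offset cs i) = size c.
  rewrite /tape ifF; last by rewrite sz_i; lia.
  by rewrite -[_ + offset _ _]addn0 baseE.
have xsS : xs i.+1 = xs i ++ square n (fun _ v => v \in c).
  by rewrite !xsE (take_nth [::] lt_i) map_rcons flatten_rcons -!catA.
pose mid q zs := (frame n B q 0 0 0 0 0 0 (B + 2 + offset cs i).+1 (size c) (M - i) 0 0 0 0,
              tape base zs) : state.
apply: (@runs_le _ _ _ _ (3 + (h + 5).+1).+1); first by lia.
apply: (@runs_seq _ _ _ _ (mid (size (xs i)) (xs i))).
  straight_line; rewrite readE.
  by rewrite /mid; arith.
apply: (@runs_seq _ _ _ _ (mid (size (xs i.+1)) (xs i.+1))); last first.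
  straight_line.
  by rewrite /st offsetS // -/c; arith.
apply: (@runs_le _ _ _ _ (n * (n * ((20 * size c + 11) + 11) + 12) + 7)).
  by rewrite /h leq_add2r leq_mul // leq_add2r leq_mul //; lia.
rewrite /mid xsS size_cat size_square.
apply: runs_block => //; try lia.
  move=> ru rv u v zs un vn szB.
  apply: runs_clause_bit => //; try lia.
    by apply: sub_all lt_n => l; lia.
  by move=> j lt_j; rewrite addSnnS baseE.
Qed.

Lemma runs_reduction :
  runs V (reduction k.+1) (nseq 18 0, nth 0 w) (nseq 18 0, nth 0 (system_code n cs))
    (300 * k.+1 * B).
Proof.
have xs0 : xs 0 = [:: n; M.+1] ++ square n (fun u v => v == partner u) ++
    square n (fun _ _ => 1) by rewrite xsE take0 cats0.
have -> : system_code n cs = xs M by rewrite xsE take_size.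
have szM := size_xs (leqnn M).
have MnB : M + 2 <= (M + 2) * (n * n) by nia.
have B2 : (M + 2) * (n * n) + 2 <= B by rewrite BE; nia.
have nn : n <= n * n by nia.
pose mm := (n * (n * (20 * k + 22) + 12) + 19).
(* The step bounds of the phases, in program order. *)
pose S := 13 + ((n * 4).+1 + (11 + (((M + 2) * 4).+1 + (9 + ((B * 16).+1 + (13 + 
  ((n * (n * (17 + 11) + 12) + 7) + ((n * (n * (1 + 11) + 12) + 7) + 
  (M * mm + 14 + ((B * 6).+1 + 9).+1).+1).+1).+1).+1).+1).+1).+1).+1).+1.
apply: (@runs_le _ _ _ _ S.+1).
  (* Every phase is linear in [B], which dominates [M * n ^ 2]; the factor [k] comes from the clause
     phase. *)
  have X1 : M * (n * n) <= B by lia.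
  have X2 : M * n <= B by rewrite (leq_trans _ X1) // leq_mul2l nn orbT.
  have X3 : M * mm <= (20 * k + 53) * B.
    have -> : M * mm = (20 * k + 22) * (M * (n * n)) + 12 * (M * n) + 19 * M.
      by rewrite /mm; lia.
    have : (20 * k + 22) * (M * (n * n)) <= (20 * k + 22) * B by rewrite leq_mul2l X1 orbT.
    by lia.
  have X4 : n * n <= B by lia.
  have kB0 : 0 <= k * B by [].
  move: X3; rewrite /S; move: (M * mm) => Mmm X3.
  rewrite !mulnDr ![n * (n * _)]mulnA; lia.
have w0 : nth 0 w 0 = N by [].
have w1 : nth 0 w 1 = M by [].
pose fr B q j a c l d := frame n B q 0 0 0 0 0 0 0 0 j a c l d.
apply: (@runs_seq _ _ _ _ (fr 0 0 M 0 n n 0, nth 0 w)).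
  by straight_line; rewrite ?w0 ?w1 /fr; arith.
apply: (@runs_seq _ _ _ _ (fr 0 0 M 0 0 n (n * n), nth 0 w)).
  by apply: runs_mul_acc; lia.
apply: (@runs_seq _ _ _ _ (fr 0 0 M k.+1 (M + 2) (n * n + k.+1) 2, nth 0 w)).
  by straight_line; rewrite /fr; arith.
apply: (@runs_seq _ _ _ _ (fr 0 0 M k.+1 0 (n * n + k.+1) B, nth 0 w)).
  by rewrite BE; apply: runs_mul_acc; lia.
apply: (@runs_seq _ _ _ _ (fr B 0 M 0 B 0 0, nth 0 w)).
  by straight_line; rewrite /fr; arith.
apply: (@runs_seq _ _ _ _ (fr B 0 M B 0 0 0, tape base [::])).
  exact: runs_move.
apply: (@runs_seq _ _ _ _ (fr B 2 M 0 0 0 0, tape base [:: n; M.+1])).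
  straight_line.
  rewrite /fr -(update_tape _ [:: n]) -(update_tape _ [::]); arith.
  by rewrite add0n addn1.
apply: (@runs_seq _ _ _ _ (fr B (2 + n * n) M 0 0 0 0,
    tape base ([:: n; M.+1] ++ square n (fun u v => v == partner u)))).
  apply: (@runs_block V n B base 0 0 M _ _ partner_bit (fun u v => v == partner u) 17
    (fun u v => leq_b1 _) _ [:: n; M.+1]) => [|//|ru rv u v zs un vn szB|/=]; try lia.
  by apply: runs_partner_bit => //; lia.
apply: (@runs_seq _ _ _ _ (fr B (size (xs 0)) M 0 0 0 0, tape base (xs 0))).
  have -> : size (xs 0) = 2 + n * n + n * n by rewrite size_xs //; lia.
  rewrite xs0 catA.
  have sz2 : size ([:: n; M.+1] ++ square n (fun u v => v == partner u)) = 2 + n * n.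
    by rewrite size_cat size_square.
  rewrite -sz2; apply: (@runs_block V n B base 0 0 M _ _ (SetConst rBit 1)
    (fun _ _ => 1)) => //; try lia.
  by move=> ru rv u v zs un vn szB; straight_line.
apply: (@runs_seq _ _ _ _ (frame n B (size (xs M)) 0 0 0 0 0 0 0 0 0 B B 0 0,
    tape base (xs M))).
  exact: runs_clauses.
(* Erasing the copy leaves in memory exactly the code of the system, as [start] requires. *)
pose erased i x := if x < size (xs M) then nth 0 (xs M) x
  else if x < B + i then 0 else base x.
pose st i := (frame n B (size (xs M)) 0 0 0 0 0 0 0 0 0 (B + i) (B - i) 0 0, erased i) : state.
apply: (@runs_seq _ _ _ _ (st B)); last first.
  straight_line; rewrite /st; arith; apply/funext => x; rewrite /erased /base.
  case: ltnP => [//|le_x]; rewrite [RHS]nth_default //.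
  by case: ltnP => // le_BBx; rewrite ifF ?nth_default //; lia.
have -> : (frame n B (size (xs M)) 0 0 0 0 0 0 0 0 0 B B 0 0, tape base (xs M)) = st 0.
  rewrite /st; arith; apply/funext => x; rewrite /erased /tape addn0 /base.
  by case: ltnP => //; case: ltnP.
apply: (@runs_loop _ _ _ st) => [|//|i lt_i]; first by lia.
straight_line; rewrite /st; arith; apply/funext => x; rewrite /update /erased addnS ltnS.
case: (ltngtP x (B + i)) => [lt_x|lt_x|->] //.
by rewrite ifF //; lia.
Qed.

End Spec.

End Reduction.

(** * Satisfying assignments versus good independent sets, and the size of k-CNF formulas *)

Section Correctness.
Local Open Scope nat_scope.
Local Set Implicit Arguments.
Local Unset Strict Implicit.

Lemma encode_rel_square n (E : rel 'I_n) (f : nat -> nat -> nat) :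
  (forall u v : 'I_n, E u v = f u v :> nat) -> encode_rel E = square n f.
Proof.
move=> Ef; rewrite /encode_rel /square /mkseq -val_enum_ord -map_comp.
congr flatten; apply: eq_map => u /=; rewrite -map_comp.
by apply: eq_map => v /=.
Qed.

Definition clause_code N (C : seq ('I_N * bool)) : seq nat :=
  [seq (l : 'I_N * bool).1.*2 + l.2 | l <- C].

Lemma encode_cnf_code N (F : cnf N) :
  encode_cnf F = formula_code N [seq clause_code C | C <- F].
Proof.
rewrite /encode_cnf /formula_code size_map -map_comp; congr [:: _, _ & flatten _].
by apply: eq_map => C /=; rewrite size_map.
Qed.

Lemma partnerE u : partner u = if odd u then u.-1 else u.+1.
Proof. by rewrite /partner; case: odd => /=; lia. Qed.

Lemma partner_neq u : partner u != u.
Proof. by rewrite partnerE; case: ifP; case: u => //= u _; lia. Qed.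

Lemma odd_partner u : odd (partner u) = ~~ odd u.
Proof.
by rewrite partnerE; case: ifP => [|ou] /=; [case: u => //= u /negbTE->|rewrite ou].
Qed.

Lemma partnerK : involutive partner.
Proof.
move=> u; rewrite (partnerE (partner u)) odd_partner partnerE.
by case: (boolP (odd u)) => //=; case: u.
Qed.

Lemma half_partner u : (partner u)./2 = u./2.
Proof. by rewrite partnerE; have := odd_double_half u; case: ifP => /=; lia. Qed.

Section System.
Variables (N : nat) (F : cnf N).
Let n := N.+1 + N.+1.

Let adjacent : rel 'I_n := fun u v => (v : nat) == partner u.

Let adjacent_sym : symmetric adjacent.
Proof.
move=> u v; rewrite /adjacent; apply/eqP/eqP => [->|->]; by rewrite partnerK.
Qed.

Let adjacent_irr : irreflexive adjacent.
Proof. by move=> u; rewrite /adjacent eq_sym; apply/negbTE/partner_neq. Qed.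

(** The complete digraph ensures m >= 1 even for the empty formula; it makes every vertex of a set
    good for it. *)
Definition literal_system : graph_system 'I_n :=
  @GraphSystem 'I_n adjacent
    ((fun _ _ => true) :: [seq (fun _ v : 'I_n => (v : nat) \in clause_code C) | C <- F])
    adjacent_sym adjacent_irr isT.

Lemma encode_literal_system :
  encode_system literal_system = system_code n [seq clause_code C | C <- F].
Proof.
rewrite /encode_system /system_code /= !size_map; congr (_ :: _ :: _).
rewrite (@encode_rel_square _ _ (fun u v => v == partner u)) //.
rewrite (@encode_rel_square _ _ (fun _ _ => 1)) //; congr (_ ++ (_ ++ _)).
rewrite -!map_comp; congr flatten; apply: eq_map => C /=.
exact: encode_rel_square.
Qed.

Lemma has_GIS_literal_system : has_GIS literal_system = satisfiable F.
Proof.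
have lit_lt (l : 'I_N * bool) : l.1.*2 + l.2 < n.
  by case: l => i b /=; have := ltn_ord i; rewrite /n; case: b => /=; lia.
apply/existsP/existsP => [[Gamma]|[a aF]].
  move=> /and3P[/set0Pn[u uG] /forall_inP indep /forall_inP gd].
  (* A variable with neither literal in [Gamma] becomes false. By independence, a negative literal
     in [Gamma] excludes the positive one. *)
  exists [ffun i : 'I_N => [exists v in Gamma, v == i.*2.+1 :> nat]].
  apply/allP => C CF.
  have /= := allP (gd u uG) (fun _ v : 'I_n => (v : nat) \in clause_code C).
  rewrite inE map_f ?orbT // => /(_ isT)/exists_inP[v vG /mapP[l lC vE]].
  apply/hasP; exists l => //; rewrite ffunE; case: l vE {lC} => i [] /= vE.
    by apply/eqP/exists_inP; exists v; rewrite // vE addn1.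
  rewrite eqbF_neg; apply/negP => /exists_inP[v' v'G /eqP v'E].
  have /forall_inP/(_ v' v'G)/negP := indep v vG; apply.
  by rewrite /= /adjacent v'E vE addn0 /partner odd_double !subn0.
(* [insub] fails on the extra variable [N], which thus becomes false; [Gamma] consists of all true
   literals. *)
pose b i : bool := if insub i is Some j then a j else false.
pose Gamma := [set v : 'I_n | odd v == b v./2].
exists Gamma; apply/and3P; split.
(* The vertex numbered [b 0] is the true literal of variable 0, which exists even for [N = 0] thanks
   to the extra variable. *)
- have lt0 : b 0 < n by rewrite /n; case: (b 0) => /=; lia.
  by apply/set0Pn; exists (Ordinal lt0); rewrite inE /=; case E: (b 0); rewrite /= E.
- apply/forall_inP => u; rewrite inE => /eqP uE; apply/forall_inP => v; rewrite inE => /eqP vE.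
  apply/negP => /eqP /= vu; move: vE.
  by rewrite vu odd_partner half_partner -uE; case: odd.
apply/forall_inP => u uG; apply/allP => E; rewrite inE => /orP[/eqP->|/mapP[C CF ->]].
  by apply/exists_inP; exists u.
have /hasP[l lC /eqP al] := allP aF C CF.
apply/exists_inP; exists (Ordinal (lit_lt l)); last by apply: map_f.
rewrite inE /=; case: l al {lC} => i c /= <-.
rewrite oddD odd_double oddb addFb halfD odd_double /= doubleK.
have -> : (a i : nat)./2 = 0 by case: (a i).
by rewrite add0n addn0 /b insubT // => lt; rewrite (_ : Sub _ _ = i) //; apply: val_inj.
Qed.

End System.

(** Clauses of length at most k embed into the functions from ['I_k] to optional literals, and [F]
    has no repeated clause. *)
Lemma size_kcnf k N (F : cnf N) : is_kcnf k F -> size F <= (N * 2).+1 ^ k.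
Proof.
move=> /andP[uF /allP kF].
pose pad (C : seq ('I_N * bool)) := [ffun i : 'I_k => onth C i].
have pad_inj : {in F &, injective pad}.
  move=> C D /kF sC /kF sD /ffunP eqCD; apply: eq_from_onth => i.
  case: (ltnP i k) => [lt_i|le_i]; first by have := eqCD (Ordinal lt_i); rewrite !ffunE.
  by rewrite !onth_default // (leq_trans _ le_i).
rewrite -(size_map pad) -(card_uniqP _); last by rewrite map_inj_in_uniq.
apply: leq_trans (max_card _) _.
by rewrite card_ffun card_option card_prod !card_ord card_bool.
Qed.

(** * Answers and running time of the reduction followed by a CIS program *)

Lemma card_take_drop h t (P Q : pred (seq bool)) :
  #|[set c : (h + t).-tuple bool | P (take h c) && Q (drop h c)]| =
  #|[set c : h.-tuple bool | P c]| * #|[set c : t.-tuple bool | Q c]|.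
Proof.
rewrite -cardsX; pose f (x : h.-tuple bool * t.-tuple bool) := cat_tuple x.1 x.2.
have f_inj : injective f.
  move=> [x1 x2] [y1 y2] /(congr1 val)/= /eqP; rewrite eqseq_cat ?size_tuple //.
  by case/andP => /eqP/val_inj-> /eqP/val_inj->.
rewrite -(card_imset _ f_inj); apply: eq_card => c; rewrite inE.
apply/idP/imsetP => [/andP[Pc Qc]|[[x1 x2]]].
  have s1 : size (take h c) == h by rewrite size_takel // size_tuple leq_addr.
  have s2 : size (drop h c) == t by rewrite size_drop size_tuple addKn.
  exists (Tuple s1, Tuple s2); first by rewrite !inE /= Pc Qc.
  by apply: val_inj; rewrite /= cat_take_drop.
rewrite !inE /= => /andP[Px Qx] ->.
by rewrite /= take_size_cat ?drop_size_cat ?size_tuple // Px Qx.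
Qed.

Lemma card_drop h t (Q : pred (seq bool)) :
  #|[set c : (h + t).-tuple bool | Q (drop h c)]| = 2 ^ h * #|[set c : t.-tuple bool | Q c]|.
Proof.
have <- : #|[set c : h.-tuple bool | predT (val c)]| = 2 ^ h.
  by rewrite cardsE card_tuple card_bool.
by rewrite -card_take_drop.
Qed.

Lemma card_take h t (P : pred (seq bool)) :
  #|[set c : (h + t).-tuple bool | P (take h c)]| = #|[set c : h.-tuple bool | P c]| * 2 ^ t.
Proof.
have <- : #|[set c : t.-tuple bool | predT (val c)]| = 2 ^ t.
  by rewrite cardsE card_tuple card_bool.
by rewrite -card_take_drop; apply: eq_card => c; rewrite !inE andbT.
Qed.

(** [P] ends in the initial configuration of [A] on [w'], up to the clock, after a number of steps
    that does not depend on the coins. *)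
Lemma run_after V P A w w' s :
  runs V P (nseq 18 0, nth 0 w) (nseq 18 0, nth 0 w') s ->
  exists h, forall coins, h <= size coins ->
    exists2 t, t <= 1 + s * (2 * V + 3) &
      run (Seq P A) w coins = shift_clock t (run A w' (drop h coins)).
Proof.
(* The additional step, of cost 1, unfolds [Seq]. *)
move=> [h le_hs runP]; exists h.+1 => -[|b coins] //; rewrite /= ltnS => le_h.
have [t le_t eq_t] := runP [:: A] 1 (take h coins) (size_takel le_h).
exists t; first by apply: leq_trans le_t _; rewrite leq_add2l leq_mul2r le_hs orbT.
have zeroE : nth 0 (nseq 18 0) = fun=> 0.
  by apply/funext => i; rewrite nth_nseq if_same.
rewrite /run -/(steps _ _) /= -[in LHS](cat_take_drop h coins) -/(steps _ _).
rewrite zeroE /= in eq_t; rewrite steps_cat eq_t.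
by rewrite -/(steps _ _) -shift_clock_steps /shift_clock /= addn0.
Qed.

(** The result does not depend on the first [h] coins, so the count of coin sequences and the total
    both gain the factor [2 ^ h]. *)
Lemma answers_after V P A w w' s b :
  runs V P (nseq 18 0, nth 0 w) (nseq 18 0, nth 0 w') s ->
  answers A w' b -> answers (Seq P A) w b.
Proof.
move=> /(run_after A)[h runE] [t [haltA probA]]; exists (h + t).
have le_h (c : (h + t).-tuple bool) : h <= size c by rewrite size_tuple leq_addr.
split=> [c|].
  have [t' _ ->] := runE c (le_h c).
  have sz : size (drop h c) == t by rewrite size_drop size_tuple addKn.
  exact: haltA (Tuple sz).
rewrite (_ : #|_| = 2 ^ h * #|[set c : t.-tuple bool | output (run A w' c) == b]|).
  by rewrite expnD mulnCA [3 * _]mulnCA leq_mul2l probA orbT.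
rewrite -(card_drop h t (fun c => output (run A w' c) == b)).
by apply: eq_card => c; rewrite !inE; have [t' _ ->] := runE c (le_h c).
Qed.

Lemma clock_after V P A w w' s coins :
  runs V P (nseq 18 0, nth 0 w) (nseq 18 0, nth 0 w') s ->
  exists coins',
    clock (run (Seq P A) w coins) <= 1 + s * (2 * V + 3) + clock (run A w' coins').
Proof.
move=> /(run_after A)[h runE].
(* The given coins may end before [P] does; [h] more coins complete it and can only increase the
   clock. *)
have [|t le_t E] := runE (coins ++ nseq h true).
  by rewrite size_cat size_nseq leq_addl.
exists (drop h (coins ++ nseq h true)).
apply: (@leq_trans (clock (run (Seq P A) w (coins ++ nseq h true)))).
  by rewrite /run foldl_cat; apply: clock_steps.
by rewrite E /= leq_add2r.
Qed.

Section Reduction.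
Variables (k N : nat) (F : cnf N).
Hypothesis kF : is_kcnf k F.
Let n := N.+1 + N.+1.
Definition copy_base := 2 + (size F + 2) * (n * n + k.+1).

Lemma runs_reduction_cnf :
  runs (2 * copy_base + 5) (reduction k.+1)
    (nseq 18 0, nth 0 (encode_cnf F)) (nseq 18 0, nth 0 (encode_system (literal_system F)))
    (300 * k.+1 * copy_base).
Proof.
rewrite encode_cnf_code encode_literal_system.
apply: (runs_reduction _ _ _ _ _ (fun _ => erefl)) => //.
- by rewrite /copy_base size_map.
- apply/allP => _ /mapP[C CF ->]; rewrite size_map.
  by case/andP: kF => _ /allP/(_ C CF).
apply/allP => _ /mapP[C _ ->]; apply/allP => _ /mapP[[i b] _ ->] /=.
by have := ltn_ord i; case: b => /=; lia.
Qed.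

End Reduction.

End Correctness.

(** * An adversary bound on the number of memory reads *)

Section Queries.
Local Open Scope nat_scope.
Local Set Implicit Arguments.
Local Unset Strict Implicit.

Definition read_at (c : config) : seq nat :=
  if todo c is ReadMem _ y :: _ then [:: regs c y] else [::].

Fixpoint reads (c : config) (coins : seq bool) : seq nat :=
  if coins is b :: s then read_at c ++ reads (step b c) s else [::].

(** Each read costs at least one time unit. *)
Lemma size_reads c coins : size (reads c coins) + clock c <= clock (steps c coins).
Proof.
elim: coins c => //= b s IH c; rewrite size_cat; apply: leq_trans (IH (step b c)).
have : size (read_at c) + clock c <= clock (step b c); last by lia.
case: (boolP (halted c)) => [hc|/(clock_step b)].
  by rewrite halted_step //; case: c hc => -[].
by move=> lt; apply: leq_trans lt; rewrite /read_at; case: (todo c) => [|[]].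
Qed.

(** [D] marks the cells where the memories may differ. Writes preserve agreement outside [D], and
    only reads could carry a difference into the registers. *)
Lemma steps_unread (D : pred nat) c c' coins :
  todo c = todo c' -> regs c = regs c' ->
  (forall a, ~~ D a -> memory c a = memory c' a) ->
  ~~ has D (reads c coins) -> regs (steps c coins) = regs (steps c' coins).
Proof.
elim: coins c c' => //= b s IH [td r m t] [_ _ m' t'] /= <- <- eqm.
rewrite has_cat negb_or => /andP[unread unreads].
apply: IH unreads; case: td unread => [|[x k|x y z|x y z|x y|x y|x|p q|x p] s'] //=.
  by rewrite /read_at /= orbF => /eqm->.
by move=> _ a Da; rewrite /update; case: eqP => // _; apply: eqm.
Qed.

(** [answers] with the number of coins exposed, so that different inputs can be compared on the same
    coin sequences. *)
Definition answers_by (p : program) (w : seq nat) (b : bool) (t : nat) : Prop :=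
  (forall coins : t.-tuple bool, halted (run p w coins)) /\
  2 * 2 ^ t <= 3 * #|[set coins : t.-tuple bool | output (run p w coins) == b]|.

Lemma answers_by_add p w b t s : answers_by p w b t -> answers_by p w b (t + s).
Proof.
move=> [halt prob].
have runE (c : (t + s).-tuple bool) : run p w c = run p w (take t c).
  have sz : size (take t c) == t by rewrite size_takel // size_tuple leq_addr.
  rewrite -[in LHS](cat_take_drop t c) /run foldl_cat.
  exact: (halted_steps _ (halt (Tuple sz))).
split=> [c|].
  rewrite runE; have sz : size (take t c) == t by rewrite size_takel // size_tuple leq_addr.
  exact: (halt (Tuple sz)).
rewrite (_ : #|_| = #|[set c : t.-tuple bool | output (run p w c) == b]| * 2 ^ s).
  by rewrite expnD !mulnA leq_mul2r prob orbT.
rewrite -(card_take t s (fun c => output (run p w c) == b)).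
by apply: eq_card => c; rewrite !inE runE.
Qed.

Lemma nth_flatten_uniform (T : Type) (x0 : T) b (ss : seq (seq T)) x : 0 < b ->
  all (fun s => size s == b) ss ->
  nth x0 (flatten ss) x = nth x0 (nth [::] ss (x %/ b)) (x %% b).
Proof.
move=> b0; elim: ss x => [|s ss IH] x /=; first by rewrite !nth_nil.
case/andP=> /eqP sb /IH {}IH; rewrite nth_cat sb; case: ltnP => [lt_x|le_x].
  by rewrite divn_small // modn_small.
by rewrite IH -{3 4}(subnK le_x) divnDr // divnn b0 addn1 modnDr.
Qed.

Section Adversary.
Variables (n m : nat).
Hypothesis m0 : 0 < m.

(* The j-th digraph is complete if P j, and empty otherwise. *)
Definition switch_system (P : pred nat) : graph_system 'I_n :=
  @GraphSystem 'I_n (fun _ _ => false) (mkseq (fun j _ _ => P j) m)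
    (fun _ _ => erefl) (fun _ => erefl) (etrans (congr1 (leq 1) (size_mkseq _ m)) m0).

Lemma has_GIS_switch P : 0 < n -> has_GIS (switch_system P) = all P (iota 0 m).
Proof.
move=> n0; apply/existsP/allP => [[Gamma /and3P[/set0Pn[u uG] _ /forall_inP gd]] j jm|allP_].
  have := allP (gd u uG) (fun _ _ => P j) (map_f _ jm).
  by case/exists_inP.
have u : 'I_n by exact: Ordinal n0.
exists [set u]; apply/and3P; split.
- by apply/set0Pn; exists u; rewrite inE.
- by apply/forall_inP => ? _; apply/forall_inP.
apply/forall_inP => v vu; apply/allP => E /mapP[j jm ->].
by apply/exists_inP; exists v => //; apply: allP_.
Qed.

Lemma encode_switch P : encode_system (switch_system P) =
  [:: n; m] ++ square n (fun _ _ => 0) ++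
  flatten (mkseq (fun j => square n (fun _ _ => P j)) m).
Proof.
rewrite /encode_system /= size_mkseq; congr (_ :: _ :: _).
rewrite (@encode_rel_square _ _ (fun _ _ => 0)) //; congr (_ ++ flatten _).
rewrite -map_comp; apply: eq_map => j /=; exact: encode_rel_square.
Qed.

(** After 2 header cells and [n * n] cells for [G_0], each digraph takes [n * n] cells. Truncation
    sends the earlier cells to index 0, which is harmless since all systems agree there. *)
Lemma nth_encode_switch i a : 0 < n -> i != (a - 2 - n * n) %/ (n * n) ->
  nth 0 (encode_system (switch_system predT)) a =
  nth 0 (encode_system (switch_system (predC1 i))) a.
Proof.
move=> n0; rewrite !encode_switch !nth_cat; case: ifP => // _.
rewrite !size_square; case: ifP => // _ ne; rewrite /=.
have nn : 0 < n * n by rewrite muln_gt0 n0.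
rewrite !(@nth_flatten_uniform _ _ (n * n)) //; try by
  apply/allP => s /mapP[j _ ->]; rewrite size_square.
case: (ltnP ((a - 2 - n * n) %/ (n * n)) m) => lt_m; last first.
  by rewrite !(@nth_default _ [::]) ?size_mkseq.
by rewrite !nth_mkseq //= eq_sym ne.
Qed.

End Adversary.

Lemma unbounded_time (A : program) (n T : nat) : decides_CIS A -> 0 < n ->
  ~ forall (G : graph_system 'I_n) coins, clock (run A (encode_system G) coins) <= T.
Proof.
move=> decA n0 bound; pose m := (3 * T).+1.
pose G := @switch_system n m isT.
pose w := encode_system (G predT); pose w' (i : 'I_m) := encode_system (G (predC1 (i : nat))).
have [t0 t0P] : exists t, answers_by A w true t.
  have [t tP] := decA _ (G predT); exists t.
  by rewrite has_GIS_switch // all_predT in tP.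
have /choice[ti tiP] : forall i, exists t, answers_by A (w' i) false t.
  move=> i; have [t tP] := decA _ (G (predC1 (i : nat))); exists t.
  rewrite has_GIS_switch // in tP; move: tP; rewrite (_ : all _ _ = false) //.
  by apply/negbTE/allPn; exists (i : nat); rewrite ?mem_iota ?ltn_ord //= eqxx.
(* The sum is a number of coins that suffices for all these inputs at once. *)
pose t := t0 + \sum_i ti i.
have [_ probw] : answers_by A w true t by apply: answers_by_add.
have probw' i : 2 * 2 ^ t <= 3 * #|[set c : t.-tuple bool | output (run A (w' i) c) == false]|.
  suff [] : answers_by A (w' i) false t by [].
  by rewrite /t (bigD1 i) //= addnCA; apply: answers_by_add.
pose D i a := nth 0 w a != nth 0 (w' i) a.
pose bad i := [set c : t.-tuple bool | has (D i) (reads (start A w) c)].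
(* Both answers are right on at least 2/3 + 2/3 - 1 = 1/3 of the coins. They differ, so on such
   coins the run on [w] reads a cell where [w] and [w' i] differ. *)
have bad_ge i : 2 ^ t <= 3 * #|bad i|.
  set S := [set c : t.-tuple bool | output (run A w c) == true] in probw.
  have := probw' i; set S' := [set c : t.-tuple bool | _] => probw'i.
  have : #|S :&: S'| <= #|bad i|.
    apply/subset_leq_card/fintype.subsetP => c; rewrite !inE => /andP[/eqP Sc /eqP S'c].
    apply/negPn/negP => nbad.
    have regsE : regs (run A w c) = regs (run A (w' i) c).
      by apply: steps_unread nbad => // a; rewrite /D negbK => /eqP.
    by move: Sc S'c; rewrite /output regsE => ->.
  have : #|S :|: S'| <= 2 ^ t.
    by apply: leq_trans (max_card _) _; rewrite card_tuple card_bool.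
  by have := cardsUI S S'; lia.
(* Double counting: a run makes at most [T] reads, and each cell distinguishes [w] from [w' i] for
   at most one [i]. *)
have sum_bad : \sum_i #|bad i| <= 2 ^ t * T.
  have -> : \sum_i #|bad i| = \sum_(c : t.-tuple bool) \sum_i (c \in bad i).
    rewrite exchange_big /=; apply: eq_bigr => i _.
    by rewrite -sum1_card big_mkcond.
  apply: leq_trans (_ : \sum_(c : t.-tuple bool) T <= _); last first.
    by rewrite sum_nat_const card_tuple card_bool.
  apply: leq_sum => c _.
  have := leq_trans (size_reads (start A w) c) (bound (G predT) c); rewrite addn0.
  apply: leq_trans.
  under eq_bigr do rewrite inE.
  elim: (reads _ _) => [|a rs IH] /=; first by rewrite big1.
  apply: leq_trans (_ : \sum_i (D i a + has (D i) rs) <= _).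
    by apply: leq_sum => i _; case: (D i a); case: has.
  rewrite big_split /= -add1n; apply: leq_add => //.
  pose j := (a - 2 - n * n) %/ (n * n).
  have Dj i : D i a -> (i : nat) = j.
    move=> Di; apply/eqP; apply: contraTT Di => ne.
    by rewrite /D negbK; apply/eqP/nth_encode_switch.
  apply: leq_trans (_ : \sum_(i < m) ((i : nat) == j) <= _).
    by apply: leq_sum => i _; case: (boolP (D i a)) => // /Dj->; rewrite eqxx.
  case: (ltnP j m) => [lt_j|le_j].
    by rewrite (bigD1 (Ordinal lt_j)) //= eqxx big1 // => i; rewrite -val_eqE /= => /negbTE->.
  by rewrite big1 // => i _; case: eqP => // ij; have := ltn_ord i; rewrite ij ltnNge le_j.
have : \sum_(i < m) 2 ^ t <= 3 * (2 ^ t * T).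
  apply: leq_trans (_ : \sum_(i < m) 3 * #|bad i| <= _); first exact: leq_sum.
  by rewrite -big_distrr leq_mul2l sum_bad.
rewrite sum_nat_const card_ord /m mulnCA mulnC leq_mul2l.
by rewrite ltnn orbF; apply/negP; rewrite -lt0n expn_gt0.
Qed.

End Queries.

(** * Polynomial bounds for fixed k *)

Section CostBounds.
Local Open Scope nat_scope.

Lemma leq_expn2r m n k : m <= n -> m ^ k <= n ^ k.
Proof. by case: k => // k; rewrite leq_exp2r. Qed.

Lemma copy_base_le k N (F : cnf N) : is_kcnf k F ->
  copy_base k F <= (2 + (2 ^ k + 2) * (k + 5)) * N.+1 ^ k.+2.
Proof.
move=> /size_kcnf leF; rewrite /copy_base; set x := N.+1.
have x0 : 0 < x by [].
have leM : size F + 2 <= (2 ^ k + 2) * x ^ k.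
  rewrite mulnDl leq_add //; last by rewrite leq_pmulr // expn_gt0.
  by apply: leq_trans leF _; rewrite -expnMn; apply: leq_expn2r; lia.
have leN : (N.+1 + N.+1) * (N.+1 + N.+1) + k.+1 <= (k + 5) * x ^ 2.
  rewrite -/x; have : 0 < x ^ 2 by rewrite expn_gt0.
  by rewrite -mulnn; nia.
rewrite [leqRHS]mulnDl leq_add //; first by rewrite leq_pmulr // expn_gt0.
have -> : x ^ k.+2 = x ^ k * x ^ 2 by rewrite -expnD addn2.
by rewrite mulnACA; apply: leq_mul.
Qed.

(** Step count and cost per step are both linear in [copy_base], whence twice the exponent k + 2. *)
Lemma reduction_cost_le k : exists D, forall N (F : cnf N), is_kcnf k F ->
  1 + 300 * k.+1 * copy_base k F * (2 * (2 * copy_base k F + 5) + 3) <=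
  D * N.+1 ^ (k.+2 + k.+2).
Proof.
set b := 2 + (2 ^ k + 2) * (k + 5).
exists (1 + 300 * k.+1 * b * (4 * b + 13)) => N F /copy_base_le.
rewrite -/b; move: (copy_base k F) => B; rewrite expnD.
have : 0 < N.+1 ^ k.+2 by rewrite expn_gt0.
move: (N.+1 ^ k.+2) => y y0 leB.
rewrite [leqRHS]mulnDl mul1n leq_add //; first by rewrite muln_gt0 y0.
rewrite [leqRHS]mulnACA; apply: leq_mul; first by rewrite -[leqRHS]mulnA leq_mul2l leB orbT.
by rewrite [leqRHS]mulnDl; apply: leq_trans (_ : 4 * B + 13 <= _); nia.
Qed.

(** The exponent k + 1 absorbs the additional complete digraph, as n >= 2. *)
Lemma literal_system_poly k N (F : cnf N) : is_kcnf k F ->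
  size (digraphs (literal_system F)) <= (N.+1 + N.+1) ^ k.+1.
Proof.
move=> /size_kcnf leF; rewrite /= size_map; set n := N.+1 + N.+1.
have : size F <= n ^ k.
  by apply: leq_trans leF _; apply: leq_expn2r; lia.
have : 0 < n ^ k by rewrite expn_gt0.
rewrite expnS; have : 2 <= n by rewrite /n; lia.
by nia.
Qed.

End CostBounds.

(** * Exponential growth rates and the lower bounds *)

Section Growth.
Local Open Scope ring_scope.
Import Order.TTheory GRing.Theory Num.Theory.

Lemma succ_le_exp (R : realType) (e : R) : 1 < e ->
  forall N : nat, N.+1%:R <= (1 + (e - 1)^-1) * e ^+ N.
Proof.
move=> e1 N; have d0 : 0 < e - 1 by rewrite subr_gt0.
have eE : e = 1 + (e - 1) by rewrite addrC subrK.
move: (e - 1) d0 eE => d d0 ->.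
have bern : 1 + N%:R * d <= (1 + d) ^+ N.
  elim: N => [|N IH]; first by rewrite mul0r addr0.
  rewrite exprS; apply: le_trans (_ : (1 + d) * (1 + N%:R * d) <= _); last first.
    by rewrite ler_pM2l // addr_gt0.
  rewrite mulrDl mul1r mulrDr mulr1 addrA -natr1 mulrDl mul1r addrA lerDl.
  by rewrite !mulr_ge0 // ltW.
(* By Bernoulli's inequality; the product expands to [N + 1 + N * d + d^-1]. *)
apply: le_trans (_ : (1 + d^-1) * (1 + N%:R * d) <= _); last first.
  by rewrite ler_pM2l // addr_gt0 // invr_gt0.
rewrite mulrDl mul1r mulrDr mulr1 mulrCA mulVf ?gt_eqF // mulr1 -natr1.
rewrite [leLHS]addrC; apply: lerD; first by rewrite lerDl mulr_ge0 // ltW.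
by rewrite lerDr invr_ge0 ltW.
Qed.

(** Induction on the degree with [e] split as [sqrt e * sqrt e]: one root absorbs a factor N + 1,
    the other the remaining power. *)
Lemma poly_le_exp (R : realType) (q : nat) (e : R) : 1 < e ->
  exists2 C : R, 0 <= C & forall N : nat, N.+1%:R ^+ q <= C * e ^+ N.
Proof.
elim: q e => [|q IH] e e1.
  by exists 1 => // N; rewrite expr0 mul1r exprn_ege1 // ltW.
have e0 : 0 <= e by rewrite (le_trans ler01) // ltW.
have s1 : 1 < Num.sqrt e by rewrite -sqrtr1 ltr_sqrt // (lt_trans ltr01).
have [C C0 leC] := IH _ s1.
have c0 : 0 <= 1 + (Num.sqrt e - 1)^-1.
  by rewrite addr_ge0 // invr_ge0 subr_ge0 ltW.
exists ((1 + (Num.sqrt e - 1)^-1) * C) => [|N]; first by rewrite mulr_ge0.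
rewrite exprS -{2}(sqr_sqrtr e0) -exprM mulnC exprM expr2.
rewrite mulrACA ler_pM // ?exprn_ge0 //; exact: succ_le_exp.
Qed.

Lemma decides_reduction k A : decides_CIS A -> decides_kSAT k (Seq (reduction k.+1) A).
Proof.
move=> decA N F kF; rewrite -has_GIS_literal_system.
exact: answers_after (runs_reduction_cnf kF) (decA _ _).
Qed.

(** The polynomial cost of the reduction is added to the time of [A] and absorbed by [e2 ^ N], as
    [e2 > 1]; moreover [e1 ^ (2 N + 2) <= e1 ^ 2 * e2 ^ N]. *)
Lemma kSAT_time (R : realType) k (A : program) (e1 e2 : R) : 1 <= e1 -> e1 ^+ 2 < e2 ->
  is_O (fun n => worst_time R A (CIS_poly_inputs k.+1 n)) (fun n => e1 ^+ n) ->
  is_O (fun N => worst_time R (Seq (reduction k.+1) A) (kSAT_inputs k N)) (fun N => e2 ^+ N).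
Proof.
move=> e1_ge1 e12 [C [n0 leC]].
have e2_gt1 : 1 < e2 by rewrite (le_lt_trans _ e12) // exprn_ege1.
have [D leD] := reduction_cost_le k.
have [Q Q0 leQ] := @poly_le_exp R (k.+2 + k.+2) e2 e2_gt1.
(* The absolute value covers a constant [C] that might be negative. *)
exists (D%:R * Q + `|C| * e1 ^+ 2), n0 => N le_n0N.
apply: ge_ereal_sup => _ [_ [F kF <-] [coins ->]]; rewrite lee_fin.
have [coins' le_clock] := clock_after A coins (runs_reduction_cnf kF).
set n := (N.+1 + N.+1)%N.
have le_n : (n0 <= n)%N by rewrite /n; lia.
have leA : (clock (run A (encode_system (literal_system F)) coins'))%:R <= C * e1 ^+ n.
  rewrite -lee_fin; apply: le_trans (leC n le_n).
  apply: ereal_sup_ubound; exists (encode_system (literal_system F)); last by exists coins'.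
  by exists (literal_system F) => //; apply: literal_system_poly kF.
apply: le_trans (_ : D%:R * N.+1%:R ^+ (k.+2 + k.+2) + C * e1 ^+ n <= _).
  rewrite -natrX -natrM; apply: le_trans (lerD (lexx _) leA).
  by rewrite -natrD ler_nat (leq_trans le_clock) // leq_add2r leD.
rewrite mulrDl lerD //; first by rewrite -mulrA ler_wpM2l.
apply: le_trans (_ : `|C| * e1 ^+ n <= _).
  by rewrite ler_wpM2r ?ler_norm // exprn_ge0 // (le_trans ler01).
have -> : n = (2 + 2 * N)%N by rewrite /n; lia.
rewrite exprD mulrA exprM ler_wpM2l //.
  by rewrite mulr_ge0 // exprn_ge0 // (le_trans ler01).
apply: lerXn2r; last exact: ltW.
  by rewrite nnegrE exprn_ge0 // (le_trans ler01).
by rewrite nnegrE ltW // (lt_trans ltr01).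
Qed.

(** For each n >= 1 no finite time bound holds on all systems with n vertices, in particular none
    below [sqrt 2 ^ n]. *)
Lemma CIS_time_Omega (R : realType) (A : program) : decides_CIS A ->
  is_Omega (fun n => worst_time R A (CIS_inputs n)) (fun n => (Num.sqrt 2 : R) ^+ n).
Proof.
move=> hA.
exists 1, 1%N; split=> // n n0; rewrite mul1r leNgt; apply/negP => lt_time.
set x := Num.sqrt 2 ^+ n in lt_time.
apply: (@unbounded_time A n (Num.bound x) hA n0) => G coins.
rewrite -(ler_nat R) ltW // (le_lt_trans _ (archi_boundP _)) ?exprn_ge0 //.
rewrite -lee_fin ltW // (le_lt_trans _ lt_time) //.
by apply: ereal_sup_ubound; exists (encode_system G); [exists G|exists coins].
Qed.

Lemma CIS_poly_time (R : realType) (A : program) (e : R) : SETH R -> decides_CIS A ->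
  0 < e -> e < Num.sqrt 2 ->
  exists d : nat,
    ~ is_O (fun n => worst_time R A (CIS_poly_inputs d n)) (fun n => e ^+ n).
Proof.
move=> seth hA e0 es.
(* Raising the base to at least 1 makes its powers monotone in the exponent and still leaves it
   below [sqrt 2]. *)
have [e1 [e1_ge1 e_le e1s]] : exists e1 : R, [/\ 1 <= e1, e <= e1 & e1 < Num.sqrt 2].
  exists (Num.max e 1); rewrite !le_max !lexx orbT; split=> //.
  by rewrite gt_max es -[X in X < _]sqrtr1 ltr_sqrt ?ltr1n.
have e1_2 : e1 ^+ 2 < 2.
  rewrite -(@sqr_sqrtr R 2) // ltrXn2r ?nnegrE //; exact: le_trans ler01 _.
pose e2 := (e1 ^+ 2 + 2) / 2.
have [e12 e2_2] : e1 ^+ 2 < e2 /\ e2 < 2 by rewrite /e2 !midf_lt.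
have e2_0 : 0 < e2 by rewrite (le_lt_trans _ e12) // exprn_ge0 // (le_trans ler01).
(* SETH provides a k with [kSAT_const k > e2]; the reduction for this k contradicts it. *)
have [k _ /(_ k (leqnn k)) /= lt_k] := cvgr_gt _ seth _ e2_2.
exists k.+1 => -[C [n0 leC]].
suff : kSAT_const R k <= e2 by rewrite leNgt lt_k.
apply: ge_inf; first by exists 0 => x [/ltW].
split=> //; exists (Seq (reduction k.+1) A); split; first exact: decides_reduction.
apply: (@kSAT_time R k A e1 e2 e1_ge1 e12); exists `|C|, n0 => n /leC le_n.
apply: le_trans le_n _; rewrite lee_fin.
apply: le_trans (_ : `|C| * e ^+ n <= _).
  by rewrite ler_wpM2r ?ler_norm // exprn_ge0 // ltW.
by rewrite ler_wpM2l // lerXn2r ?nnegrE ?(ltW e0) // (le_trans (ltW e0)).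
Qed.

End Growth.

Local Open Scope ring_scope.

(* The first conjunct is the literal Omega (sqrt 2 ^ n), with the worst case  *)
(* taken over all systems on n vertices; their number of directed graphs is   *)
(* not bounded in terms of n.  The second one says that the lower bound does  *)
(* not come from long inputs: no base below sqrt 2 is achieved on all the     *)
(* systems with polynomially many directed graphs.  In particular A does not  *)
(* run in time O(e ^ n * poly(n + m)) for any e < sqrt 2.                     *)
Theorem theorem2p4 (R : realType) (seth : SETH R)
    (A : program) (hA : decides_CIS A) :
  is_Omega (fun n : nat => worst_time R A (CIS_inputs n))
           (fun n : nat => (Num.sqrt 2 : R) ^+ n) /\
  (forall e : R, 0 < e -> e < Num.sqrt 2 ->
     exists d : nat,
       ~ is_O (fun n : nat => worst_time R A (CIS_poly_inputs d n))
              (fun n : nat => e ^+ n)).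
Proof.
by split=> [|e]; [apply: CIS_time_Omega|apply: CIS_poly_time].
Qed.
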